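(* Let $F$ and $G$ be fixed graphs with $\chi(G)\le\chi(F)$. Suppose that there are two distinct nonadjacent vertices $u,v$ of $F$ such that (A) $u$ and $v$ have at most one common neighbor in $F$; and (B) there is no homomorphism from $G$ to $F$, and there is no homomorphism from $G$ to $F/\{u,v\}$. Then $\mathrm{ex}_F(n,G)$ does not attain the lower bound $\frac{n^2}{v(F)^2}+o(n^2)$; that is, it is not the case that $\mathrm{ex}_F(n,G)=\frac{n^2}{v(F)^2}+o(n^2)$ as $n\to\infty$.
   Context: All graphs are finite and simple; $v(F)$ is the number of vertices of $F$ and $\chi$ denotes the chromatic number. $F/\{u,v\}$ is the simple graph obtained from $F$ by identifying (shrinking) the nonadjacent vertices $u,v$ into a single vertex. For graphs $F$ and $G$, the $F$-multicolor Turán number $\mathrm{ex}_F(n,G)$ is the maximum number of pairwise edge-disjoint copies of $F$ on a common vertex set of $n$ vertices such that the union of these copies contains no copy of $G$ whose edges all come from pairwise distinct copies of $F$ in the family (that is, giving each chosen copy of $F$ its own color, there is no rainbow copy of $G$). It is known that if there is no homomorphism from $G$ to $F$, then $\frac{n^2}{v(F)^2}+o(n^2)\le \mathrm{ex}_F(n,G)$; this is the ''lower bound'' in question. *)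

(* Defs.v *)
From mathcomp Require Import all_boot.

Set Implicit Arguments.
Unset Strict Implicit.
Unset Printing Implicit Defensive.

Record sgraph := SGraph {
  vertex :> finType;
  adj : rel vertex;
  adj_sym : symmetric adj;
  adj_irrefl : irreflexive adj }.

Definition hom_exists (G F : sgraph) : Prop :=
  exists h : G -> F, forall x y : G, adj x y -> adj (h x) (h y).

Definition colorable (F : sgraph) (k : nat) : bool :=
  [exists c : {ffun F -> 'I_k}, forall x, forall y, adj x y ==> (c x != c y)].

Lemma colorable_ex (F : sgraph) : exists k, colorable F k.
Proof.
exists #|F|; apply/existsP; exists [ffun x => enum_rank x].
apply/forallP => x; apply/forallP => y; apply/implyP => xy; rewrite !ffunE.
by apply: contraTneq xy => /enum_rank_inj ->; rewrite adj_irrefl.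
Qed.

Definition chromatic_number (F : sgraph) : nat := ex_minn (colorable_ex F).

Definition common_neighbors (F : sgraph) (u v : F) : {set F} :=
  [set w | adj u w && adj v w].

Section Identify.
Variables (F : sgraph) (u v : F).

Definition merge (x : F) : F := if x == v then u else x.

(* The merged vertex is represented by u: the vertices of F/{u,v} are the
   fixed points of merge. *)
Definition identify_vertex : finType := {x : F | merge x == x}.

(* The condition x != y only discards the loop that would arise if u and v were
   adjacent. *)
Definition identify_adj : rel identify_vertex := fun x y =>
  (x != y) &&
  [exists a : F, exists b : F,
    [&& merge a == val x, merge b == val y & adj a b]].

Lemma identify_sym : symmetric identify_adj.
Proof.
suff H x y : identify_adj x y -> identify_adj y x.
  by move=> x y; apply/idP/idP; apply: H.
case/andP=> xy /existsP[a /existsP[b /and3P[ax bby ab]]].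
rewrite /identify_adj eq_sym xy; apply/existsP; exists b; apply/existsP.
by exists a; rewrite ax bby adj_sym.
Qed.

Lemma identify_irrefl : irreflexive identify_adj.
Proof. by move=> x; rewrite /identify_adj eqxx. Qed.

Definition identify : sgraph := SGraph identify_sym identify_irrefl.

End Identify.

Definition edges (F : sgraph) : {set {set F}} :=
  [set [set p.1; p.2] | p : F * F & adj p.1 p.2].

(* A subgraph of the complete graph on n vertices: its vertices and edges. *)
Definition subgraph (n : nat) : finType :=
  ({set 'I_n} * {set {set 'I_n}})%type.

Definition is_copy (n : nat) (F : sgraph) (H : subgraph n) : bool :=
  [exists f : {ffun F -> 'I_n}, injectiveb f &&
    (H == ([set f x | x : F], [set f @: (e : {set F}) | e in edges F]))].

Definition edge_disjoint (n : nat) (S : {set subgraph n}) : bool :=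
  [forall H1 in S, forall H2 in S, (H1 != H2) ==> [disjoint H1.2 & H2.2]].

Definition has_rainbow_copy (n : nat) (G : sgraph) (S : {set subgraph n}) :
    bool :=
  [exists H : subgraph n, exists c : {ffun {set 'I_n} -> subgraph n},
    [&& is_copy G H,
        [forall e in H.2, (c e \in S) && (e \in (c e).2)] &
        dinjectiveb c (mem H.2)]].

Definition multicolor_turan (F G : sgraph) (n : nat) : nat :=
  \max_(S : {set subgraph n} |
         [&& [forall H in S, is_copy F H], edge_disjoint S &
             ~~ has_rainbow_copy G S]) #|S|.

(* Main.v *)
Require Import Defs.
From mathcomp Require Import all_boot all_order all_algebra.
From mathcomp Require Import ring lra zify.
From mathcomp Require Import all_classical all_reals all_analysis.

(* Every union of copies of F inside a blow-up of F/{u,v} maps homomorphically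
   to F/{u,v}, hence is free of G.  So it is enough to pack edge-disjoint copies
   of F into such a blow-up more efficiently than n^2/v(F)^2.  Let c be the only
   possible common neighbor of u and v.  With N copies, the pair (U, V_c), where
   U is the part of the merged vertex, must provide 2N edges, and every other
   pair of parts only N.  Taking |U| = (4/3) q, |V_c| = (3/2) q and all the
   other parts of size q = p^2 leaves room for about q^2 copies, on only
   (v(F) - 1/6) q vertices.

   Such a packing is explicit: the copies are indexed by a, d in [0, 6k) and
   b, e in F_p, where p is a prime and k = p %/ 6.  A vertex w outside {u,v,c}
   with slope s is sent to (s a + b, s d + e); c is sent to (e, l(a, d)), and u
   and v are sent to (b, m_0(a, d)) and (b, m_1(a, d)), where l is injective in
   a, each m_i is injective in d, and (i, a, d) |-> (l(a, d), m_i(a, d)) is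
   injective. *)

Set Implicit Arguments.
Unset Strict Implicit.
Unset Printing Implicit Defensive.

Import Order.TTheory GRing.Theory Num.Theory.
Import numFieldNormedType.Exports.

(* The merge of path.v hides the one of Defs. *)
Local Notation merge := Defs.merge.

(** * From packings in a labelled host to the multicolor Turán number *)

Lemma merge_adj_neq (F : sgraph) (u v x y : F) :
  ~~ adj u v -> adj x y -> merge u v x != merge u v y.
Proof.
move=> uv xy; rewrite /merge; apply: contraTneq xy.
have [->|_] := eqVneq x v; have [->|_] := eqVneq y v.
- by rewrite adj_irrefl.
- by move=> <-; rewrite adj_sym.
- by move=> ->.
- by move=> ->; rewrite adj_irrefl.
Qed.

Lemma merge_idem (F : sgraph) (u v x : F) : merge u v (merge u v x) == merge u v x.
Proof. by rewrite /merge; case: (x =P v) => [_|/eqP/negPf->]; rewrite ?eqxx //; case: ifP. Qed.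

(** Through [lab], every edge of the union of the copies becomes an edge of [identify u v], so a
    copy of [G] in the union would give a forbidden homomorphism. The last hypothesis encodes
    edge-disjointness: an oriented host edge determines its copy. *)
Lemma packing_leq_turan (F G : sgraph) (u v : F) (P T : finType)
    (f : T -> F -> P) (lab : P -> F) :
  ~~ adj u v -> (exists x y : F, adj x y) -> ~ hom_exists G (identify u v) ->
  (forall t, injective (f t)) ->
  (forall t x, lab (f t x) = merge u v x) ->
  (forall t t' (x y x' y' : F), adj x y -> adj x' y' ->
     f t x = f t' x' -> f t y = f t' y' -> t = t') ->
  #|T| <= multicolor_turan F G #|P|.
Proof.
move=> uv [x0 [y0 xy0]] noG f_inj labf f_edge.
pose g t : {ffun F -> 'I_#|P|} := [ffun x => enum_rank (f t x)].
pose cp t : subgraph #|P| :=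
  ([set g t x | x : F], [set g t @: (e : {set F}) | e in edges F]).
have edgeP t e : e \in (cp t).2 ->
    exists x y : F, adj x y /\ e = [set enum_rank (f t x); enum_rank (f t y)].
  case/imsetP=> _ /imsetP[[x y] /= xy ->] ->.
  by exists x, y; rewrite imsetU1 imset_set1 !ffunE; split=> //; rewrite inE in xy.
have cp_edge t t' e : e \in (cp t).2 -> e \in (cp t').2 -> t = t'.
  case/edgeP=> x [y [xy ->]] /edgeP[x' [y' [xy']]] E.
  have nxy : enum_rank (f t x) != enum_rank (f t y).
    by apply: contraTneq xy => /enum_rank_inj/f_inj ->; rewrite adj_irrefl.
  have : enum_rank (f t x) \in [set enum_rank (f t' x'); enum_rank (f t' y')].
    by rewrite -E set21.
  have : enum_rank (f t y) \in [set enum_rank (f t' x'); enum_rank (f t' y')].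
    by rewrite -E set22.
  rewrite !inE => /orP[]/eqP Ey /orP[]/eqP Ex; rewrite ?Ex ?Ey ?eqxx // in nxy.
    rewrite adj_sym in xy'.
    by apply: (f_edge _ _ _ _ _ _ xy xy'); apply: enum_rank_inj.
  by apply: (f_edge _ _ _ _ _ _ xy xy'); apply: enum_rank_inj.
(* An edge in each copy turns edge-disjointness into injectivity of [cp], so the family has [#|T|]
   members. *)
have cp0 t : exists e, e \in (cp t).2.
  exists (g t @: [set x0; y0]); apply: imset_f.
  by apply/imsetP; exists (x0, y0); rewrite ?inE.
have cp_inj : injective cp.
  by move=> t t' E; have [e et] := cp0 t; apply: (cp_edge _ _ e et); rewrite -E.
rewrite -(card_imset _ cp_inj) /multicolor_turan.
apply: (@leq_bigmax_cond _ _ (fun S : {set subgraph #|P|} => #|S|)).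
apply/and3P; split.
- apply/forall_inP => H /imsetP[t _ ->]; apply/existsP; exists (g t).
  rewrite eqxx andbT; apply/injectiveP => x y; rewrite !ffunE.
  by move/enum_rank_inj/f_inj.
- apply/forall_inP => _ /imsetP[t _ ->]; apply/forall_inP => _ /imsetP[t' _ ->].
  apply/implyP => ne; rewrite -setI_eq0; apply/set0Pn => -[e].
  by rewrite inE => /andP[et et']; rewrite (cp_edge _ _ _ et et') eqxx in ne.
- apply/negP => /existsP[H /existsP[col /and3P[Hc /forall_inP Hcol _]]].
  have /existsP[h /andP[/injectiveP h_inj /eqP EH]] := Hc.
  apply: noG.
  (* The outer [merge] supplies the fixed-point proof; by idempotence it leaves the labels of the
     copies unchanged. *)
  pose hom (x : G) : identify u v :=
    exist _ (merge u v (lab (enum_val (h x)))) (merge_idem u v _).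
  exists hom => x y xy.
  have : h @: [set x; y] \in H.2.
    rewrite EH; apply: imset_f; apply/imsetP; exists (x, y) => //.
    by rewrite inE.
  move=> /Hcol/andP[/imsetP[t _ ->]] /edgeP[a [b [ab]]].
  rewrite imsetU1 imset_set1 => E.
  have hxy: h x != h y.
    by apply: contraTneq xy => /h_inj ->; rewrite adj_irrefl.
  have sfin (a' b' : F) : adj a' b' ->  h x = enum_rank (f t a') ->
      h y = enum_rank (f t b') -> identify_adj (hom x) (hom y).
    move=> ab' Ea Eb; have mE z : merge u v (merge u v z) = merge u v z.
      by apply/eqP/merge_idem.
    rewrite /identify_adj -val_eqE /= Ea Eb !enum_rankK !labf !mE.
    rewrite (merge_adj_neq uv ab') /=.
    by apply/existsP; exists a'; apply/existsP; exists b'; rewrite !eqxx.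
  have : h x \in [set enum_rank (f t a); enum_rank (f t b)] by rewrite -E set21.
  have : h y \in [set enum_rank (f t a); enum_rank (f t b)] by rewrite -E set22.
  rewrite !inE => /orP[]/eqP Ey /orP[]/eqP Ex; rewrite ?Ex ?Ey ?eqxx // in hxy.
    by apply: (sfin b a); rewrite // adj_sym.
  exact: (sfin a b).
Qed.

(* ctable and utable give l and m_r at the scale of a 2 x 3 grid of blocks, with
   3 and 4 values respectively; r = true is the role of v.  All 12 pairs of
   values occur exactly once, by cutable_inj. *)
Definition ctable (a : bool) (d : option bool) : option bool :=
  match a, d with
  | false, None | false, Some false => None
  | true, Some _ => Some false
  | _, _ => Some true
  end.

Definition utable (r a : bool) (d : option bool) : bool * bool :=
  match r, a, d with
  | false, false, None => (false, false)
  | false, false, Some false => (false, true)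
  | false, false, Some true => (true, false)
  | true, false, None => (true, false)
  | true, false, Some false => (true, true)
  | true, false, Some true => (false, false)
  | false, true, None => (false, true)
  | false, true, Some false => (false, false)
  | false, true, Some true => (true, true)
  | true, true, None => (true, true)
  | true, true, Some false => (false, true)
  | true, true, Some true => (true, false)
  end.

Lemma ctable_inj a a' d : ctable a d = ctable a' d -> a = a'.
Proof. by case: a a' d => [] [] [[]|]. Qed.

Lemma utable_inj r a d d' : utable r a d = utable r a d' -> d = d'.
Proof. by case: r a d d' => [] [] [[]|] [[]|]. Qed.

Lemma cutable_inj r r' a a' d d' :
  ctable a d = ctable a' d' -> utable r a d = utable r' a' d' ->
  [/\ r = r', a = a' & d = d'].
Proof. by case: r r' a a' d d' => [] [] [] [] [[]|] [[]|]. Qed.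

(** * The explicit packing and its edge-disjointness *)

Section Packing.
Local Open Scope ring_scope.

Variables (F : sgraph) (u v c : F) (K : finFieldType) (k : nat).
Hypotheses (uv_neq : u != v) (uv_nonadj : ~~ adj u v).
Hypotheses (cu : c != u) (cv : c != v).
Hypothesis c_common : forall w, adj u w -> adj v w -> w = c.

(* pos3 and pos2 embed the ranges of a and d into the field. *)
Variables (slope : F -> K) (pos3 : bool * 'I_(3 * k) -> K)
  (pos2 : option bool * 'I_(2 * k) -> K).
Hypotheses (slope_inj : injective slope) (slope_neq0 : forall x, slope x != 0).
Hypotheses (pos3_inj : injective pos3) (pos2_inj : injective pos2).

Definition others : finType := {w : F | w \notin [:: u; v; c]}.

(** In order: the part of the merged vertex, of size [8 * k * #|K|]; that of [c], of size
    [9 * k * #|K|]; and parts of size [#|K| ^ 2]. *)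
Definition hosts : finType :=
  (K * (bool * bool * 'I_(2 * k)) + K * (option bool * 'I_(3 * k))
   + others * (K * K))%type.

Definition indices : finType :=
  (bool * 'I_(3 * k) * (option bool * 'I_(2 * k)) * (K * K))%type.

Definition place (t : indices) (x : F) : hosts :=
  let: (a, d, (b, e)) := t in
  match insub x with
  | Some w => inr (w, (slope x * pos3 a + b, slope x * pos2 d + e))
  | None =>
    if x == c then inl (inr (e, (ctable a.1 d.1, a.2)))
    else inl (inl (b, (utable (x == v) a.1 d.1, d.2)))
  end.

Definition host_label (q : hosts) : F :=
  match q with
  | inl (inl _) => u
  | inl (inr _) => c
  | inr (w, _) => val w
  end.

Lemma place_others t (x : F) (xo : x \notin [:: u; v; c]) :
  place t x = inr (Sub x xo,
    (slope x * pos3 t.1.1 + t.2.1, slope x * pos2 t.1.2 + t.2.2)).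
Proof. by case: t => [[a d] [b e]]; rewrite /place insubT. Qed.

Lemma place_center t : place t c = inl (inr (t.2.2, (ctable t.1.1.1 t.1.2.1, t.1.1.2))).
Proof.
by case: t => [[a d] [b e]]; rewrite /place insubF ?eqxx // !inE eqxx !orbT.
Qed.

Lemma place_pair t x : x \in [:: u; v] ->
  place t x = inl (inl (t.2.1, (utable (x == v) t.1.1.1 t.1.2.1, t.1.2.2))).
Proof.
case: t => [[a d] [b e]] xuv; rewrite /place insubF; last first.
  by move: xuv; rewrite !inE; case/orP => ->; rewrite ?orbT.
rewrite ifF //; apply: contraTF xuv => /eqP->.
by rewrite !inE negb_or cu.
Qed.

Variant role_spec (x : F) : Prop :=
  | RoleOther of x \notin [:: u; v; c]
  | RoleCenter of x = c
  | RolePair of x \in [:: u; v].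

Lemma roleP x : role_spec x.
Proof.
have [xuv|xuv] := boolP (x \in [:: u; v]); first exact: RolePair.
have [->|xc] := eqVneq x c; first exact: RoleCenter.
by apply: RoleOther; move: xuv; rewrite !inE; case/norP=> /negPf-> /negPf->.
Qed.

Lemma host_label_place t x : host_label (place t x) = merge u v x.
Proof.
rewrite /merge; case: (roleP x) => [xo|->|xuv].
- rewrite place_others /=; move: xo; rewrite !inE.
  by case/norP=> _ /norP[/negPf->].
- by rewrite place_center (negPf cv).
- rewrite place_pair //=; move: xuv; rewrite !inE.
  by case/orP => /eqP->; rewrite ?eqxx // (negPf uv_neq).
Qed.

(** A host edge between these two parts may come from [u] or from [v]; [cutable_inj] recovers which,
    together with the blocks. *)
Lemma place_pair_inj t t' x y : x \in [:: u; v] -> y \in [:: u; v] ->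
  place t c = place t' c -> place t x = place t' y -> x = y /\ t = t'.
Proof.
move=> xuv yuv; rewrite !place_center !place_pair //.
case: t t' => [[[a1 a2] [d1 d2]] [b e]] [[[a1' a2'] [d1' d2']] [b' e']] /=.
case=> -> El -> [-> Em ->]; have [Er -> ->] := cutable_inj El Em.
split=> //; move: xuv yuv Er; rewrite !inE.
by case/orP=> /eqP-> /orP[]/eqP->; rewrite ?eqxx ?(negPf uv_neq).
Qed.

Lemma merge_eq (x y : F) : merge u v x = merge u v y ->
  x = y \/ x \in [:: u; v] /\ y \in [:: u; v].
Proof.
rewrite /merge !inE; have [->|_] := eqVneq x v; have [->|_] := eqVneq y v.
- by left.
- by move=> <-; right; rewrite eqxx orbT.
- by move=> ->; right; rewrite eqxx orbT.
- by left.
Qed.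

Lemma place_eq t t' (x y : F) : place t x = place t' y ->
  x = y \/ x \in [:: u; v] /\ y \in [:: u; v].
Proof. by move/(congr1 host_label); rewrite !host_label_place => /merge_eq. Qed.

Lemma place_inj t : injective (place t).
Proof.
move=> x y E; have [//|[xuv yuv]] := place_eq E.
by have [] := place_pair_inj xuv yuv (erefl (place t c)) E.
Qed.

(** The center reveals [e]; cancelling the nonzero slope gives [d], then [ctable_inj] gives [a], and
    [b] follows. *)
Lemma place_other_center t t' x : x \notin [:: u; v; c] ->
  place t x = place t' x -> place t c = place t' c -> t = t'.
Proof.
move=> xo; rewrite !(place_others _ xo) !place_center.
case: t t' => [[[a1 a2] [d1 d2]] [b e]] [[[a1' a2'] [d1' d2']] [b' e']] /=.
case=> Ea Ed [Ee El E2].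
move: Ed; rewrite Ee => /addIr /(mulfI (slope_neq0 x)) /pos2_inj.
case=> Ed1 Ed2; rewrite Ed1 in El; have Ea1 := ctable_inj El.
by move: Ea; rewrite Ea1 E2 Ed1 Ed2 => /addrI->.
Qed.

(** Dually, [b] is revealed, which gives [a], then [d] by [utable_inj], then [e]. *)
Lemma place_other_pair t t' x y : x \notin [:: u; v; c] -> y \in [:: u; v] ->
  place t x = place t' x -> place t y = place t' y -> t = t'.
Proof.
move=> xo yuv; rewrite !(place_others _ xo) !place_pair //.
case: t t' => [[[a1 a2] [d1 d2]] [b e]] [[[a1' a2'] [d1' d2']] [b' e']] /=.
case=> Ea Ed [Eb El E2].
move: Ea; rewrite Eb => /addIr /(mulfI (slope_neq0 x)) /pos3_inj.
case=> Ea1 Ea2; rewrite Ea1 in El; have Ed1 := utable_inj El.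
by move: Ed; rewrite Ed1 E2 Ea1 Ea2 => /addrI->.
Qed.

(** Both [(a, b)] and [(d, e)] solve a linear system that distinct slopes make nonsingular. *)
Lemma place_other_other t t' x y :
  x \notin [:: u; v; c] -> y \notin [:: u; v; c] -> x != y ->
  place t x = place t' x -> place t y = place t' y -> t = t'.
Proof.
move=> xo yo xy; rewrite !(place_others _ xo) !(place_others _ yo).
case: t t' => [[a d] [b e]] [[a' d'] [b' e']] /=.
case=> Ea Ed [Fa Fd].
have line (s s' i i' j j' : K) : s != s' ->
    s * i + j = s * i' + j' -> s' * i + j = s' * i' + j' -> i = i' /\ j = j'.
  move=> ss E E'; have Ei : i = i'.
    apply: (@mulfI _ (s - s')); first by rewrite subr_eq0.
    have D (y1 y2 z : K) : (y1 + z) - (y2 + z) = y1 - y2.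
      by rewrite opprD addrACA subrr addr0.
    by rewrite !mulrBl -(D _ _ j) E E' D.
  by split=> //; move: E; rewrite Ei => /addrI.
have sxy : slope x != slope y.
  by apply: contra_neq xy => /slope_inj.
have [/pos3_inj-> ->] := line _ _ _ _ _ _ sxy Ea Fa.
by have [/pos2_inj-> ->] := line _ _ _ _ _ _ sxy Ed Fd.
Qed.

Lemma pair_nonadj x y : x \in [:: u; v] -> y \in [:: u; v] -> ~~ adj x y.
Proof.
by rewrite !inE => /orP[]/eqP-> /orP[]/eqP->; rewrite ?adj_irrefl // adj_sym.
Qed.

Lemma place_edge_pair t t' (x y x' y' : F) : y \in [:: u; v] ->
  adj x y -> adj x' y' -> place t x = place t' x' -> place t y = place t' y' ->
  t = t'.
Proof.
move=> yuv xy xy' Ex Ey.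
have y'uv : y' \in [:: u; v] by have [<-|[]] := place_eq Ey.
have [xx'|[xuv _]] := place_eq Ex; last first.
  by have := pair_nonadj xuv yuv; rewrite xy.
rewrite -{x'}xx' in xy' Ex.
have [xo|xc|xuv] := roleP x.
- suff yy' : y = y' by rewrite -yy' in Ey; exact: (place_other_pair xo yuv).
  have nc : x != c by apply: contraNneq xo => ->; rewrite !inE eqxx !orbT.
  (* If [y] and [y'] differ, they are [u] and [v], and [x] is a common neighbor. *)
  apply: contraNeq nc => yy'; apply/eqP/c_common; move: yuv y'uv yy' xy xy';
    rewrite !inE => /orP[]/eqP-> /orP[]/eqP->; rewrite ?eqxx //;
    by rewrite ![adj x _]adj_sym.
- by rewrite xc in Ex; have [] := place_pair_inj yuv y'uv Ex Ey.
- by have := pair_nonadj xuv yuv; rewrite xy.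
Qed.

Lemma place_edge t t' (x y x' y' : F) :
  adj x y -> adj x' y' -> place t x = place t' x' -> place t y = place t' y' ->
  t = t'.
Proof.
move=> xy xy' Ex Ey.
have [yuv|yuv] := boolP (y \in [:: u; v]).
  exact: (place_edge_pair yuv xy xy').
have [xuv|xuv] := boolP (x \in [:: u; v]).
  by rewrite adj_sym in xy; rewrite adj_sym in xy'; apply: (place_edge_pair xuv xy xy').
have xx' : x = x' by have [|[xuv']] := place_eq Ex; rewrite ?xuv' in xuv *.
have yy' : y = y' by have [|[yuv']] := place_eq Ey; rewrite ?yuv' in yuv *.
rewrite -{x'}xx' in xy' Ex; rewrite -{y' xy'}yy' in Ey.
have nxy : x != y by apply: contraTneq xy => ->; rewrite adj_irrefl.
have [xo|xc|xuv'] := roleP x; last by rewrite xuv' in xuv.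
  have [yo|yc|yuv'] := roleP y; last by rewrite yuv' in yuv.
    exact: (place_other_other xo yo).
  by rewrite yc in Ey; apply: (place_other_center xo).
have [yo|yc|yuv'] := roleP y; last by rewrite yuv' in yuv.
  by rewrite xc in Ex; apply: (place_other_center yo).
by rewrite xc yc eqxx in nxy.
Qed.

Lemma card_others : #|others| = (#|F| - 3)%N.
Proof.
rewrite card_sig -(cardC (mem [:: u; v; c])).
have /card_uniqP -> : uniq [:: u; v; c].
  by rewrite /= !inE !negb_or uv_neq eq_sym cu eq_sym cv.
rewrite addKn; apply: eq_card => x; by rewrite !inE.
Qed.

Lemma card_hosts : #|hosts| = (17 * k * #|K| + (#|F| - 3) * #|K| ^ 2)%N.
Proof.
rewrite !(card_sum, card_prod, card_option, card_bool, card_ord) card_others.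
by congr (_ + _)%N; rewrite /= ?mulnn //; ring.
Qed.

Lemma card_indices : #|indices| = ((6 * k) ^ 2 * #|K| ^ 2)%N.
Proof.
rewrite !(card_sum, card_prod, card_option, card_bool, card_ord).
by ring.
Qed.

Lemma turan_identify_lower_bound (G : sgraph) :
  (exists x y : F, adj x y) -> ~ hom_exists G (identify u v) ->
  ((6 * k) ^ 2 * #|K| ^ 2
     <= multicolor_turan F G (17 * k * #|K| + (#|F| - 3) * #|K| ^ 2))%N.
Proof.
move=> Fe noG; rewrite -card_indices -card_hosts.
apply: (packing_leq_turan uv_nonadj Fe noG (f := place) (lab := host_label)).
- exact: place_inj.
- exact: host_label_place.
- exact: place_edge.
Qed.

End Packing.

(** * Existence of an edge and of a center *)

Lemma edge_of_no_hom (F G : sgraph) (u : F) :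
  chromatic_number G <= chromatic_number F -> ~ hom_exists G F ->
  exists x y : F, adj x y.
Proof.
move=> chiGF noGF; have [/existsP[x /existsP[y xy]]|Fe] :=
  boolP [exists x : F, exists y : F, adj x y]; first by exists x, y.
case: noGF; exists (fun=> u) => x y xy.
(* An edgeless [F] is 1-colorable, hence so is [G], which contradicts its edge [xy]. *)
suff : chromatic_number G <= 1.
  rewrite /chromatic_number; case: ex_minnP => k /existsP[c].
  move=> /forallP/(_ x)/forallP/(_ y); rewrite xy /= => cxy _ k1.
  case/eqP: cxy; apply: val_inj; move: (ltn_ord (c x)) (ltn_ord (c y)) k1 => /=.
  lia.
apply: leq_trans chiGF _; rewrite /chromatic_number.
case: ex_minnP => k _; apply; apply/existsP; exists [ffun=> ord0].
apply/forallP => a; apply/forallP => b; apply/implyP => ab; case/negP: Fe.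
by apply/existsP; exists a; apply/existsP; exists b.
Qed.

(** Without a common neighbor, any vertex outside [{u, v}] serves as center; an end of an edge is
    one, as [u] and [v] are nonadjacent. *)
Lemma exists_center (F : sgraph) (u v : F) :
  u != v -> ~~ adj u v -> (#|common_neighbors u v| <= 1)%N ->
  (exists x y : F, adj x y) ->
  exists c : F, [/\ c != u, c != v & forall w, adj u w -> adj v w -> w = c].
Proof.
move=> uv nuv /card_le1_eqP com [x [y xy]].
have [/existsP[c /andP[uc vc]]|noc] := boolP [exists c, adj u c && adj v c].
  exists c; split=> [||w uw vw].
  - by apply: contraTneq uc => ->; rewrite adj_irrefl.
  - by apply: contraTneq vc => ->; rewrite adj_irrefl.
  - by apply: com; rewrite inE ?uc ?uw.
have vacuous w c : adj u w -> adj v w -> w = c.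
  by move=> uw vw; case/existsP: noc; exists w; rewrite uw.
have [xuv|] := boolP (x \in [:: u; v]); last first.
  by rewrite !inE negb_or => /andP[xu xv]; exists x; split=> // w; exact: vacuous.
have [yuv|] := boolP (y \in [:: u; v]); last first.
  by rewrite !inE negb_or => /andP[yu yv]; exists y; split=> // w; exact: vacuous.
by have := pair_nonadj nuv xuv yuv; rewrite xy.
Qed.

(** * Specialization to prime fields and the density comparison *)

Local Open Scope classical_set_scope.
Local Open Scope ring_scope.

Lemma natr_Fp_inj (p m n : nat) : prime p -> (m < p)%N -> (n < p)%N ->
  m%:R = n%:R :> 'F_p -> m = n.
Proof.
by move=> p_prime mp np /(congr1 val); rewrite /= !val_Fp_nat // !modn_small.
Qed.

(** The shift by one lets the same map provide nonzero slopes. *)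
Lemma enum_rank_Fp_inj (p : nat) (A : finType) : prime p -> (#|A| <= p)%N ->
  injective (fun x : A => (enum_rank x).+1%:R : 'F_p).
Proof.
move=> p_prime Ap x y; rewrite -!natr1 => /addIr/(natr_Fp_inj p_prime) E.
by apply/enum_rank_inj/val_inj/E; apply: leq_trans Ap.
Qed.

Lemma enum_rank_Fp_neq0 (p : nat) (A : finType) (x : A) : prime p ->
  (#|A| < p)%N -> (enum_rank x).+1%:R != 0 :> 'F_p.
Proof.
move=> p_prime Ap; apply/eqP => /(@natr_Fp_inj p _ 0 p_prime) E.
suff: (enum_rank x).+1 = 0%N by [].
by apply: E; [apply: leq_ltn_trans Ap | apply: prime_gt0].
Qed.

(** The second conjunct ensures that the subtraction [#|F| - 3] is not truncated. *)
Lemma turan_prime_lower_bound (F G : sgraph) (u v : F) (p : nat)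
    (chiGF : (chromatic_number G <= chromatic_number F)%N)
    (uv_neq : u != v) (uv_nonadj : ~~ adj u v)
    (hA : (#|common_neighbors u v| <= 1)%N)
    (hB1 : ~ hom_exists G F)
    (hB2 : ~ hom_exists G (identify u v)) : prime p -> (#|F| < p)%N ->
  ((6 * (p %/ 6)) ^ 2 * p ^ 2
     <= multicolor_turan F G (17 * (p %/ 6) * p + (#|F| - 3) * p ^ 2))%N
  /\ (3 <= #|F|)%N.
Proof.
move=> p_prime ltFp; have Fe := edge_of_no_hom u chiGF hB1.
have [c [cu cv c_com]] := exists_center uv_neq uv_nonadj hA Fe.
have le6 : (6 * (p %/ 6) <= p)%N by lia.
have P3 : (#|{: bool * 'I_(3 * (p %/ 6))}| <= p)%N.
  by rewrite card_prod card_bool card_ord mulnA.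
have P2 : (#|{: option bool * 'I_(2 * (p %/ 6))}| <= p)%N.
  by rewrite card_prod card_option card_bool card_ord mulnA.
split.
  have := turan_identify_lower_bound uv_neq uv_nonadj cu cv c_com
    (enum_rank_Fp_inj p_prime (ltnW ltFp))
    (fun x => enum_rank_Fp_neq0 x p_prime ltFp)
    (enum_rank_Fp_inj p_prime P3) (enum_rank_Fp_inj p_prime P2) Fe hB2.
  by rewrite !card_Fp.
have /card_uniqP E : uniq [:: u; v; c].
  by rewrite /= !inE !negb_or uv_neq eq_sym cu eq_sym cv.
by have := max_card (mem [:: u; v; c]); rewrite E.
Qed.

(** Here [V] is v(F), [P] the prime and [X] the host size, at most (V - 1/6) P^2. The loss from [P]
    to [P - 5] is a factor of at least 1 - 1/(12V), because [60 * V < P]. *)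
Lemma density_gap (R : realFieldType) (V P X : R) :
  3 <= V -> 60 * V < P -> 0 <= X -> 6 * X <= P ^+ 2 * (6 * V - 1) ->
  (V ^- 2 + (24 * V ^+ 3)^-1) * X ^+ 2 < (P - 5) ^+ 2 * P ^+ 2.
Proof.
move=> V3 VP X0 leX.
have V0 : 0 < V by lra.
have P0 : 0 < P by lra.
have -> : V ^- 2 + (24 * V ^+ 3)^-1 = (24 * V + 1) / (24 * V ^+ 3).
  by field; lra.
rewrite mulrAC ltr_pdivrMr; last by rewrite mulr_gt0 ?exprn_gt0 ?ltr0n.
have leX2 : 36 * X ^+ 2 <= P ^+ 4 * (6 * V - 1) ^+ 2.
  have -> : 36 * X ^+ 2 = (6 * X) ^+ 2 by ring.
  have -> : P ^+ 4 * (6 * V - 1) ^+ 2 = (P ^+ 2 * (6 * V - 1)) ^+ 2 by ring.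
  by rewrite lerXn2r ?nnegrE //; nra.
have leP2 : P ^+ 2 * (12 * V - 1) ^+ 2 <= 144 * V ^+ 2 * (P - 5) ^+ 2.
  have -> : 144 * V ^+ 2 * (P - 5) ^+ 2 = (12 * V * (P - 5)) ^+ 2 by ring.
  by rewrite -exprMn lerXn2r ?nnegrE //; nra.
(* The cubic terms cancel, leaving 108 V^2 - 6 V - 1 > 0. *)
have gap : (24 * V + 1) * (6 * V - 1) ^+ 2 < 6 * V * (12 * V - 1) ^+ 2 by nra.
rewrite -(ltr_pM2l (_ : 0 < 36)) //.
have -> : 36 * ((24 * V + 1) * X ^+ 2) = (24 * V + 1) * (36 * X ^+ 2) by ring.
apply: (le_lt_trans (ler_wpM2l _ leX2)); first by lra.
have -> : 36 * ((P - 5) ^+ 2 * P ^+ 2 * (24 * V ^+ 3)) =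
  6 * V * P ^+ 2 * (144 * V ^+ 2 * (P - 5) ^+ 2) by ring.
apply: (lt_le_trans _ (ler_wpM2l _ leP2)); last by rewrite ?mulr_ge0 ?exprn_ge0 //; lra.
have -> : (24 * V + 1) * (P ^+ 4 * (6 * V - 1) ^+ 2) =
  P ^+ 4 * ((24 * V + 1) * (6 * V - 1) ^+ 2) by ring.
have -> : 6 * V * P ^+ 2 * (P ^+ 2 * (12 * V - 1) ^+ 2) =
  P ^+ 4 * (6 * V * (12 * V - 1) ^+ 2) by ring.
by rewrite ltr_pM2l // exprn_gt0.
Qed.

Theorem theorem1p3 (R : realType) (F G : sgraph) (u v : F)
    (chiGF : (chromatic_number G <= chromatic_number F)%N)
    (uv_neq : u != v) (uv_nonadj : ~~ adj u v)
    (hA : (#|common_neighbors u v| <= 1)%N)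
    (hB1 : ~ hom_exists G F)
    (hB2 : ~ hom_exists G (identify u v)) :
  ~ ((fun n : nat => (multicolor_turan F G n)%:R : R) =
     (fun n : nat => n%:R ^+ 2 / #|F|%:R ^+ 2 : R) +o_\oo
     (fun n : nat => n%:R ^+ 2 : R)).
Proof.
move=> /eqaddoP small.
have eps0 : 0 < (24 * #|F|%:R ^+ 3 : R)^-1.
  rewrite invr_gt0 mulr_gt0 ?exprn_gt0 ?ltr0n //.
  by apply/card_gt0P; exists u.
have [n0 _ near_n0] := small _ eps0.
(* The term [n0] puts [n] in the asymptotic range, and [60 * #|F|] is what [density_gap]
   requires. *)
have [p lt_p p_prime] := prime_above (n0 + 60 * #|F|).
have ltFp : (#|F| < p)%N by lia.
have [] := turan_prime_lower_bound chiGF uv_neq uv_nonadj hA hB1 hB2 p_prime ltFp.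
set k := (p %/ 6)%N; set n := (_ + _)%N => le_turan F3.
have k0 : (0 < k)%N by rewrite /k; lia.
have n0n : (n0 <= n)%N by rewrite /n; nia.
have := near_n0 n n0n; rewrite /= => /ler_normlW.
rewrite -[(_ - _) n]/(_ - _ : R) lerBlDl.
rewrite ger0_norm ?exprn_ge0 // [_ / _]mulrC -mulrDl.
apply/negP; rewrite -ltNge.
(* This is n <= (v(F) - 1/6) p^2, from 6k <= p and 17 + 6 (v(F) - 3) = 6 v(F) - 1. *)
have le_n : (6 * n + p ^ 2 <= p ^ 2 * (6 * #|F|))%N.
  have : (6 * k <= p)%N by rewrite /k; lia.
  rewrite /n; nia.
apply: (@lt_le_trans _ _ ((p%:R - 5) ^+ 2 * p%:R ^+ 2)).
  apply: density_gap; rewrite ?ler_nat //.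
  - by rewrite -natrM ltr_nat; apply: leq_ltn_trans lt_p; apply: leq_addl.
  - move: le_n; rewrite -(ler_nat R) !(natrX, natrD, natrM); lra.
(* The remainder of [p] modulo 6 is at most 5, whence the [P - 5] of [density_gap]. *)
have : (6 * k + 5 >= p)%N by rewrite /k; lia.
rewrite -(ler_nat R) natrD => le_k.
move: le_turan; rewrite -(ler_nat R) natrM !natrX; apply: le_trans.
rewrite ler_wpM2r ?exprn_ge0 // lerXn2r ?nnegrE //; last by lra.
by rewrite subr_ge0 ler_nat; lia.
Qed.
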